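(* Let $X$ be a reflexive Banach space. The pair $(X,c_0)$ has the weak maximizing property (WMP) if and only if it has property strict $(M)$.
   Context: The scalar field is $\mathbb{R}$ or $\mathbb{C}$; $\mathcal{L}(X,Y)$ is the Banach space of bounded linear operators; $B_X$, $S_X$ are the closed unit ball and unit sphere. A contraction is an operator of norm at most $1$. A contraction $T\in\mathcal{L}(X,Y)$ has property strict $(M)$ if whenever $x\in X$ and $y\in Y$ satisfy $\|y\|<\|x\|$, then $\limsup_n\|y+Tx_n\|<\limsup_n\|x+x_n\|$ for every weakly null sequence $(x_n)\subset X$. The pair $(X,Y)$ has property strict $(M)$ if every contraction in $\mathcal{L}(X,Y)$ has property strict $(M)$. An operator $T\in\mathcal{L}(X,Y)$ attains its norm if $\|Tx\|=\|T\|$ for some $x\in S_X$. A maximizing sequence of $T$ is a sequence $(x_n)\subset B_X$ with $\lim_n\|Tx_n\|=\|T\|$. The pair $(X,Y)$ has the WMP if every $T\in\mathcal{L}(X,Y)$ having a maximizing sequence that is not weakly null attains its norm. *)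

(* Defs.v *)
From HB Require Import structures.
From mathcomp Require Import all_boot all_order all_algebra.
From mathcomp Require Import complex.
From mathcomp Require Import all_classical all_reals all_analysis.

Set Implicit Arguments.
Unset Strict Implicit.
Unset Printing Implicit Defensive.

Import Order.TTheory GRing.Theory Num.Theory.
Import numFieldNormedType.Exports.

Local Open Scope classical_set_scope.
Local Open Scope ring_scope.

Variant scalar_kind := RealScalars | ComplexScalars.

Definition scalars (R : realType) (k : scalar_kind) : numFieldType :=
  match k with
  | RealScalars => R : numFieldType
  | ComplexScalars => R[i] : numFieldType
  end.

(* A norm takes its values in the scalar field. [scalar_re] and [scalar_of]
   move the nonnegative reals between [scalars R k] and [R], where suprema
   and upper limits live. *)
Definition scalar_re (R : realType) (k : scalar_kind) : scalars R k -> R :=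
  match k with
  | RealScalars => fun z => z
  | ComplexScalars => fun z => complex.Re z
  end.

Definition scalar_of (R : realType) (k : scalar_kind) : R -> scalars R k :=
  match k with
  | RealScalars => fun r => r
  | ComplexScalars => fun r => r%:C%C
  end.

Section scalar_theory.
Variables (R : realType) (k : scalar_kind).
Implicit Types (z : scalars R k) (a b : R).

Lemma scalar_reK z : 0 <= z -> scalar_of k (scalar_re z) = z.
Proof. by move: z; case: k => //= -[a b]; rewrite lecE /= => /andP[/eqP-> _]. Qed.

Lemma scalar_ofK a : scalar_re (scalar_of k a) = a.
Proof. by case: k. Qed.

Lemma ler_scalar_of a b : (scalar_of k a <= scalar_of k b) = (a <= b).
Proof. by case: k => //=; rewrite lecE /= eqxx. Qed.

Lemma scalar_of0 : scalar_of k (0 : R) = 0.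
Proof. by case: k. Qed.

Lemma scalar_ofD a b : scalar_of k (a + b) = scalar_of k a + scalar_of k b.
Proof. by case: k => //=; rewrite rmorphD. Qed.

Lemma scalar_ofM a b : scalar_of k (a * b) = scalar_of k a * scalar_of k b.
Proof. by case: k => //=; rewrite rmorphM. Qed.

End scalar_theory.

Section rnorm.
Variables (R : realType) (k : scalar_kind).

Definition rnorm (V : normedModType (scalars R k)) (x : V) : R :=
  scalar_re `|x|.

Lemma rnormE (V : normedModType (scalars R k)) (x : V) :
  `|x| = scalar_of k (rnorm x).
Proof. by rewrite scalar_reK. Qed.

Variable V : normedModType (scalars R k).
Implicit Types x y : V.

Lemma rnorm_ge0 x : 0 <= rnorm x.
Proof. by rewrite -(ler_scalar_of k) -rnormE scalar_of0. Qed.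

Lemma rnorm0 : rnorm (0 : V) = 0.
Proof. by rewrite /rnorm normr0 -[X in scalar_re X]scalar_of0 scalar_ofK. Qed.

Lemma rnorm_eq0 x : rnorm x = 0 -> x = 0.
Proof. by move=> x0; apply/normr0_eq0; rewrite rnormE x0 scalar_of0. Qed.

Lemma ler_rnormD x y : rnorm (x + y) <= rnorm x + rnorm y.
Proof. by rewrite -(ler_scalar_of k) scalar_ofD -!rnormE ler_normD. Qed.

Lemma rnormZ (c : (scalars R k)^o) x : rnorm (c *: x) = rnorm c * rnorm x.
Proof.
have cE : `|c : scalars R k| = scalar_of k (rnorm c) by rewrite -rnormE.
by rewrite -[LHS](scalar_ofK k) -rnormE normrZ cE rnormE -scalar_ofM scalar_ofK.
Qed.

End rnorm.

Lemma sup_imageZ (R : realType) (T : Type) (A : set T) (g : T -> R) (c : R) :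
  has_sup (g @` A) -> 0 <= c ->
  sup [set c * g t | t in A] = c * sup (g @` A).
Proof.
move=> gA c0; have [[_ [t At _]] [M gM]] := gA.
have neA : [set c * g t | t in A] !=set0 by exists (c * g t), t.
have ubA : has_ubound [set c * g t | t in A].
  exists (c * M) => _ [u Au <-]; apply: ler_wpM2l => //.
  by apply: gM; exists u.
apply/eqP; rewrite eq_le; apply/andP; split.
  apply: ge_sup => // _ [u Au <-]; apply: ler_wpM2l => //.
  by apply: ub_le_sup; [exact: gA.2|exists u].
have [{}c0|c0'] := boolP (0 < c); last first.
  have -> : c = 0 by apply/eqP; rewrite eq_le c0 leNgt c0'.
  rewrite mul0r; apply: ub_le_sup; last by exists t => //; rewrite mul0r.
  by exists 0 => _ [u _ <-]; rewrite mul0r.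
rewrite -ler_pdivlMl//; apply: ge_sup; first exact: gA.1.
move=> _ [u Au <-]; rewrite ler_pdivlMl//.
by apply: ub_le_sup => //; exists u.
Qed.

Section operators.
Variables (R : realType) (k : scalar_kind).
Variables X Y : normedModType (scalars R k).

Definition is_operator : {pred X -> Y} := fun f =>
  `[< linear f /\ exists M : R, forall x, rnorm (f x) <= M * rnorm x >].

Record operator := Operator {
  operator_fun :> X -> Y ;
  operator_subproof : operator_fun \in is_operator }.

HB.instance Definition _ := [isSub for operator_fun].
HB.instance Definition _ := [Choice of operator by <:].

Lemma is_operator_submod_closed : submod_closed is_operator.
Proof.
split.
  apply/asboolP; split=> [c u v|]; first by rewrite /= scaler0 addr0.
  by exists 0 => x; rewrite /= rnorm0 mul0r.
move=> c f g /asboolP[lf [M fM]] /asboolP[lg [N gN]].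
apply/asboolP; split=> [d u v|].
  rewrite !fctE lf lg !scalerDr !scalerA [d * c]mulrC.
  by rewrite -!addrA; congr (_ + _); rewrite !addrA; congr (_ + _); rewrite addrC.
exists (rnorm (c : (scalars R k)^o) * M + N) => x.
rewrite (le_trans (ler_rnormD _ _))// mulrDl -mulrA lerD//.
by rewrite fctE (rnormZ c) ler_wpM2l// rnorm_ge0.
Qed.

HB.instance Definition _ :=
  GRing.isSubmodClosed.Build _ _ is_operator is_operator_submod_closed.
HB.instance Definition _ := [SubChoice_isSubLmodule of operator by <:].

Implicit Types (T : operator) (x : X).

Lemma operator_is_linear T : linear T.
Proof. by have /asboolP[] := operator_subproof T. Qed.

HB.instance Definition _ T :=
  GRing.isLinear.Build (scalars R k) X Y *:%R T (operator_is_linear T).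

Definition operator_rnorm T : R :=
  sup [set rnorm (T x) | x in [set x : X | `|x| <= 1]].

Lemma unit_ballE x : (`|x| <= 1) = (rnorm x <= 1).
Proof.
rewrite rnormE -(ler_scalar_of k); congr (_ <= _).
by rewrite /scalar_of; case: (k).
Qed.

Lemma operator_has_sup T :
  has_sup [set rnorm (T x) | x in [set x : X | `|x| <= 1]].
Proof.
split; first by exists (rnorm (T 0)), 0 => //=; rewrite normr0 ler01.
have /asboolP[_ [M TM]] := operator_subproof T.
exists `|M| => _ [x /= + <-]; rewrite unit_ballE => x1.
rewrite (le_trans (TM x))// (le_trans (ler_norm _))// normrM.
by rewrite ler_piMr// ger0_norm// rnorm_ge0.
Qed.

Lemma operator_rnorm_ub T x : `|x| <= 1 -> rnorm (T x) <= operator_rnorm T.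
Proof. by move=> x1; apply: ub_le_sup; [exact: (operator_has_sup T).2|exists x]. Qed.

Lemma ler_operator_rnormD T U :
  operator_rnorm (T + U) <= operator_rnorm T + operator_rnorm U.
Proof.
apply: ge_sup; first exact: (operator_has_sup (T + U)).1.
move=> _ [x /= x1 <-]; rewrite (le_trans (ler_rnormD _ _))//.
by rewrite lerD// operator_rnorm_ub.
Qed.

Lemma operator_rnormZ (c : (scalars R k)^o) T :
  operator_rnorm (c *: T) = rnorm c * operator_rnorm T.
Proof.
rewrite -sup_imageZ ?rnorm_ge0//; last exact: operator_has_sup.
by congr sup; apply: eq_imagel => x _; rewrite -(rnormZ c).
Qed.

Lemma operator_rnorm_eq0 T : operator_rnorm T = 0 -> T = 0.
Proof.
move=> T0; apply/val_inj/funext => x /=; apply: rnorm_eq0.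
apply/eqP; rewrite eq_le rnorm_ge0 andbT.
have [->|x0] := eqVneq x 0; first by rewrite linear0 rnorm0.
have nx0 : `|x| != 0 by rewrite normr_eq0.
have := @operator_rnorm_ub T (`|x|^-1 *: x).
rewrite T0 normrZ normfV normr_id mulVf// lexx => /(_ isT).
rewrite linearZ /= (rnormZ (`|x|^-1 : (scalars R k)^o)) pmulr_rle0//.
rewrite lt_neqAle rnorm_ge0 andbT eq_sym; apply/eqP => /rnorm_eq0 /eqP.
by rewrite invr_eq0 (negbTE nx0).
Qed.

Definition operator_norm T : scalars R k := scalar_of k (operator_rnorm T).

Lemma ler_operator_normD T U :
  operator_norm (T + U) <= operator_norm T + operator_norm U.
Proof. by rewrite -scalar_ofD ler_scalar_of ler_operator_rnormD. Qed.

Lemma operator_normZ (c : scalars R k) T :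
  operator_norm (c *: T) = `|c| * operator_norm T.
Proof. by rewrite /operator_norm operator_rnormZ scalar_ofM -rnormE. Qed.

Lemma operator_norm_eq0 T : operator_norm T = 0 -> T = 0.
Proof.
move=> T0; apply: operator_rnorm_eq0.
by rewrite -(scalar_ofK k (operator_rnorm T)) [X in scalar_re X]T0
  -[X in scalar_re X]scalar_of0 scalar_ofK.
Qed.

HB.instance Definition _ := Lmodule_isNormed.Build (scalars R k) operator
  ler_operator_normD operator_normZ operator_norm_eq0.

End operators.

Notation "''L' ( X , Y )" := (operator X Y)
  (at level 8, format "''L' ( X ,  Y )") : type_scope.

Section duality.
Variables (R : realType) (k : scalar_kind) (X : normedModType (scalars R k)).

Definition dual : normedModType (scalars R k) := 'L(X, (scalars R k)^o).

End duality.

(* The canonical embedding of X into its bidual is onto. *)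
Definition reflexive_space (R : realType) (k : scalar_kind)
    (X : normedModType (scalars R k)) : Prop :=
  forall F : dual (dual X), exists x : X, forall f : dual X, F f = f x.

Section c0.
Variables (R : realType) (k : scalar_kind).
Local Notation K := (scalars R k).

Definition is_null_seq : {pred nat -> K^o} := fun u =>
  `[< u @ \oo --> (0 : K^o) >].

Record c0 := NullSeq {
  c0_seq :> nat -> K^o ;
  c0_subproof : c0_seq \in is_null_seq }.

HB.instance Definition _ := [isSub for c0_seq].
HB.instance Definition _ := [Choice of c0 by <:].

Lemma is_null_seq_submod_closed : submod_closed is_null_seq.
Proof.
split; first by apply/asboolP; exact: cvg_cst.
move=> c u v /asboolP u0 /asboolP v0; apply/asboolP.
rewrite -[X in _ --> X](addr0 (0 : K^o)) -{1}(scaler0 K^o c).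
by apply: cvgD => //; apply: cvgZr.
Qed.

HB.instance Definition _ :=
  GRing.isSubmodClosed.Build _ _ is_null_seq is_null_seq_submod_closed.
HB.instance Definition _ := [SubChoice_isSubLmodule of c0 by <:].

Implicit Types u v : c0.

Definition c0_rnorm u : R := sup [set rnorm (u n) | n in [set: nat]].

Lemma c0_has_sup u : has_sup [set rnorm (u n) | n in [set: nat]].
Proof.
split; first by exists (rnorm (u 0%N)), 0%N.
have /asboolP u0 := c0_subproof u.
have /cvg_seq_bounded/pinfty_ex_gt0[M _ uM] : cvgn (u : nat -> K^o).
  by apply/cvg_ex; exists 0.
exists (scalar_re M) => _ [n _ <-]; rewrite -(ler_scalar_of k) -rnormE.
by rewrite scalar_reK ?uM// (le_trans _ (uM n I)).
Qed.

Lemma c0_rnorm_ub u n : rnorm (u n) <= c0_rnorm u.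
Proof. by apply: ub_le_sup; [exact: (c0_has_sup u).2|exists n]. Qed.

Lemma ler_c0_rnormD u v : c0_rnorm (u + v) <= c0_rnorm u + c0_rnorm v.
Proof.
apply: ge_sup; first exact: (c0_has_sup (u + v)).1.
move=> _ [n _ <-]; rewrite (le_trans (ler_rnormD _ _))//.
by rewrite lerD// c0_rnorm_ub.
Qed.

Lemma c0_rnormZ (c : K^o) u : c0_rnorm (c *: u) = rnorm c * c0_rnorm u.
Proof.
rewrite -sup_imageZ ?rnorm_ge0//; last exact: c0_has_sup.
by congr sup; apply: eq_imagel => n _; rewrite -(rnormZ c).
Qed.

Lemma c0_rnorm_eq0 u : c0_rnorm u = 0 -> u = 0.
Proof.
move=> u0; apply/val_inj/funext => n /=; apply: rnorm_eq0.
by apply/eqP; rewrite eq_le rnorm_ge0 andbT -u0 c0_rnorm_ub.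
Qed.

Definition c0_norm u : K := scalar_of k (c0_rnorm u).

Lemma ler_c0_normD u v : c0_norm (u + v) <= c0_norm u + c0_norm v.
Proof. by rewrite -scalar_ofD ler_scalar_of ler_c0_rnormD. Qed.

Lemma c0_normZ (c : K) u : c0_norm (c *: u) = `|c| * c0_norm u.
Proof. by rewrite /c0_norm c0_rnormZ scalar_ofM -rnormE. Qed.

Lemma c0_norm_eq0 u : c0_norm u = 0 -> u = 0.
Proof.
move=> u0; apply: c0_rnorm_eq0.
by rewrite -(scalar_ofK k (c0_rnorm u)) [X in scalar_re X]u0
  -[X in scalar_re X]scalar_of0 scalar_ofK.
Qed.

HB.instance Definition _ := Lmodule_isNormed.Build K c0
  ler_c0_normD c0_normZ c0_norm_eq0.

End c0.

Section properties.
Variables (R : realType) (k : scalar_kind).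
Variables X Y : normedModType (scalars R k).

Definition weakly_null (x : nat -> X) : Prop :=
  forall f : dual X, f (x n) @[n --> \oo] --> (0 : (scalars R k)^o).

Definition attains_norm (T : 'L(X, Y)) : Prop :=
  exists2 x : X, `|x| = 1 & `|T x| = `|T|.

Definition maximizing_sequence (T : 'L(X, Y)) (x : nat -> X) : Prop :=
  (forall n, `|x n| <= 1) /\
  `|T (x n)| @[n --> \oo] --> (`|T| : (scalars R k)^o).

Definition WMP : Prop :=
  forall T : 'L(X, Y),
    (exists2 x : nat -> X, maximizing_sequence T x & ~ weakly_null x) ->
    attains_norm T.

(* The upper limits are taken in [\bar R], where they need no boundedness side
   condition. *)
Definition operator_strictM (T : 'L(X, Y)) : Prop :=
  forall (x : X) (y : Y), `|y| < `|x| ->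
    forall x_ : nat -> X, weakly_null x_ ->
      (limn_esup (fun n => (rnorm (y + T (x_ n)))%:E) <
       limn_esup (fun n => (rnorm (x + x_ n))%:E))%E.

Definition strictM : Prop :=
  forall T : 'L(X, Y), `|T| <= 1 -> operator_strictM T.

End properties.

(* Main.v *)
Require Import Defs.
From mathcomp Require Import all_boot all_order all_algebra.
From mathcomp Require Import complex.
From mathcomp Require Import all_classical all_reals all_analysis.
From mathcomp Require Import ring lra.

(** An operator into c_0 is a sequence of functionals tending weak* to [0], and
    the norm of c_0 is a maximum over coordinates.

    If the pair has the WMP but strict (M) fails for a contraction [T] at
    [x], [y] and a weakly null sequence [x_n], put [L = limsup |x + x_n|].
    This is finite because weakly null sequences are bounded
    ([weakly_null_bounded]), and it exceeds [|y|] because [|x| <= L].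
    Coordinates with bounded index cannot make [|y + T x_n|] as large as [L]:
    there [T x_n] tends to [0], and [y] is too small. So the upper limit of
    [|y + T x_n|], which is at least [L], comes from coordinates that escape to
    infinity; those no longer distinguish [y] from [T x], so that
    [|(T (x + x_n))_m|] comes close to [L] along some indices [m] tending to
    infinity ([escaping_coordinates]).
    Multiplying the coordinate chosen at step [j] by [1 - 1/(j+1)] gives an
    operator of norm [1] all of whose coordinate functionals have norm less
    than [1], so that it does not attain its norm. The vectors [x + x_n],
    rescaled into the ball, are maximizing for it and tend weakly to [x / L],
    which is not [0] ([WMP_strictM]).

    Conversely, a bounded sequence in a reflexive space has a weakly convergent
    subsequence ([weakly_convergent_subsequence]). A maximizing sequence of [T]
    that is not weakly null thus has a subsequence [z + z_n] with [z <> 0] and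
    [z_n] weakly null. If [T], normalized to norm [1], did not attain its norm,
    then [|T z| < |z|], and strict (M) at [z], [T z] would give
    [limsup |T (z + z_n)| < limsup |z + z_n| <= 1], while the left-hand side
    is [1] ([strictM_WMP]).

    Both directions rest on the Hahn-Banach theorem for real and complex
    scalars and on limits of bounded sequences of functionals along an
    ultrafilter, which replace weak* compactness of the dual ball. Throughout,
    functionals are handled through their real parts, which determine them
    ([complexify], [weakly_nullP]). *)

Set Implicit Arguments.
Unset Strict Implicit.
Unset Printing Implicit Defensive.

Import Order.TTheory GRing.Theory Num.Theory.
Import numFieldNormedType.Exports.

Local Open Scope classical_set_scope.
Local Open Scope ring_scope.

(** * Scalars *)

Section scalars_re_im.
Variables (R : realType) (k : scalar_kind).
Local Notation K := (scalars R k).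
Implicit Types (z w : K) (a b : R).

Definition scalar_i : K :=
  match k with
  | RealScalars => 0
  | ComplexScalars => ('i)%C
  end.

Lemma scalar_of1 : scalar_of k (1 : R) = 1.
Proof. by case: k. Qed.

Lemma ltr_scalar_of a b : (scalar_of k a < scalar_of k b) = (a < b).
Proof. by case: k => //=; rewrite ltcE /= eqxx. Qed.

Lemma scalar_ofN a : scalar_of k (- a) = - scalar_of k a.
Proof. by case: k => //=; rewrite rmorphN. Qed.

Lemma scalar_reD z w : scalar_re (z + w) = scalar_re z + scalar_re w.
Proof. by move: z w; case: k => //= -[? ?] [? ?]. Qed.

Lemma scalar_reN z : scalar_re (- z) = - scalar_re z.
Proof. by move: z; case: k => //= -[? ?]. Qed.

Lemma scalar_reB z w : scalar_re (z - w) = scalar_re z - scalar_re w.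
Proof. by rewrite scalar_reD scalar_reN. Qed.

Lemma scalar_re0 : scalar_re (0 : K) = 0.
Proof. by case: k. Qed.

Lemma scalar_reZ a z : scalar_re (scalar_of k a * z) = a * scalar_re z.
Proof. by move: z; case: k => //= -[? ?] /=; rewrite mul0r subr0. Qed.

Lemma scalar_i_cases : scalar_i = 0 \/ scalar_i * scalar_i = -1.
Proof. by rewrite /scalar_i; case: k; [left|right; rewrite -expr2 sqr_i]. Qed.

(** Over the reals the imaginary unit is [0], so that this decomposition
    holds for both kinds of scalars. *)
Lemma scalar_decomp z :
  z = scalar_of k (scalar_re z) -
      scalar_i * scalar_of k (scalar_re (scalar_i * z)).
Proof.
rewrite /scalar_i; move: z; case: k => /= [z|[a b]]; first by rewrite mul0r subr0.
by apply/eqP; rewrite eq_complex /=; apply/andP; split; apply/eqP; ring.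
Qed.

Lemma rnorm_scalar_of a : rnorm (scalar_of k a : K^o) = `|a|.
Proof.
rewrite /rnorm; case: k => //=.
by rewrite expr0n addr0 sqrtr_sqr.
Qed.

Lemma ler_scalar_re z : `|scalar_re z| <= rnorm (z : K^o).
Proof.
rewrite /rnorm; move: z; case: k => //= -[a b] /=.
by rewrite -sqrtr_sqr ler_wsqrtr// lerDl sqr_ge0.
Qed.

Lemma rnormM z w : rnorm (z * w : K^o) = rnorm (z : K^o) * rnorm (w : K^o).
Proof. exact: (@rnormZ R k (K^o) z w). Qed.

Lemma rnorm_scalar_i : rnorm (scalar_i : K^o) <= 1.
Proof.
rewrite /rnorm /scalar_i; case: k => /=; first by rewrite normr0.
by rewrite expr0n/= add0r expr1n sqrtr1.
Qed.

Lemma scalar_rotate z :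
  exists2 w, rnorm (w : K^o) <= 1 & w * z = scalar_of k (rnorm (z : K^o)).
Proof.
have [->|z0] := eqVneq z 0.
  by exists 0; rewrite ?rnorm0 ?mul0r// scalar_of0.
exists (`|z| / z); last by rewrite divfK// -rnormE.
rewrite /rnorm normrM normfV normr_id divff ?normr_eq0//.
by rewrite -scalar_of1 scalar_ofK.
Qed.

Lemma scalar_rat_approx z (e : R) : 0 < e ->
  exists q : rat * rat, rnorm (z - (scalar_of k (ratr q.1) +
    scalar_i * scalar_of k (ratr q.2)) : K^o) < e.
Proof.
move=> e0.
have approx (a : R) : exists q : rat, `|a - ratr q| < e / 2.
  have [|q] := @rat_in_itvoo R (a - e / 2) (a + e / 2); first by lra.
  rewrite in_itv/= => /andP[h1 h2]; exists q.
  by rewrite ltr_distlC; apply/andP; split; lra.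
have [q1 h1] := approx (scalar_re z).
have [q2 h2] := approx (- scalar_re (scalar_i * z)).
exists (q1, q2) => /=; rewrite {1}[z]scalar_decomp.
rewrite (_ : _ - _ = scalar_of k (scalar_re z - ratr q1) +
   scalar_i * scalar_of k (- scalar_re (scalar_i * z) - ratr q2)); last first.
  by rewrite !scalar_ofD !scalar_ofN; ring.
rewrite (le_lt_trans (ler_rnormD _ _))// rnormM !rnorm_scalar_of.
have := rnorm_scalar_i; have := @rnorm_ge0 R k (K^o) scalar_i.
have := normr_ge0 (- scalar_re (scalar_i * z) - ratr q2).
by nra.
Qed.

End scalars_re_im.
Arguments scalar_i {R k}.

Section rnorm_extra.
Variables (R : realType) (k : scalar_kind) (V : normedModType (scalars R k)).
Implicit Types x y : V.

Lemma rnormN x : rnorm (- x) = rnorm x.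
Proof. by rewrite /rnorm normrN. Qed.

Lemma ler_rnormB x y : rnorm x - rnorm y <= rnorm (x - y).
Proof. by rewrite lerBlDr (le_trans _ (ler_rnormD _ _))// subrK. Qed.

Lemma rnormZ_of (a : R) x : rnorm (scalar_of k a *: x) = `|a| * rnorm x.
Proof. by rewrite (rnormZ (scalar_of k a : (scalars R k)^o)) rnorm_scalar_of. Qed.

Lemma rnorm_gt0 x : x != 0 -> 0 < rnorm x.
Proof.
move=> x0; rewrite lt_neqAle rnorm_ge0 andbT eq_sym.
by apply: contra_neq x0; exact: rnorm_eq0.
Qed.

End rnorm_extra.

(** * Operators *)

Section operators_extra.
Variables (R : realType) (k : scalar_kind).
Variables X Y : normedModType (scalars R k).

Lemma operator_of (f : X -> Y) (M : R) : linear f ->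
  (forall x, rnorm (f x) <= M * rnorm x) ->
  exists T : 'L(X, Y), forall x, T x = f x.
Proof.
move=> lf fM; have Pf : f \in is_operator (X := X) (Y := Y).
  by apply/asboolP; split=> //; exists M.
by exists (Operator Pf).
Qed.

Lemma rnorm_operator (T : 'L(X, Y)) : rnorm T = operator_rnorm T.
Proof. by rewrite /rnorm [`|T|]/(operator_norm T) scalar_ofK. Qed.

Lemma ler_rnorm_operator (T : 'L(X, Y)) x : rnorm (T x) <= rnorm T * rnorm x.
Proof.
rewrite rnorm_operator.
have [->|x0] := eqVneq x 0; first by rewrite linear0 !rnorm0 mulr0.
have nx := rnorm_gt0 x0.
have := @operator_rnorm_ub R k X Y T (scalar_of k (rnorm x)^-1 *: x).
rewrite unit_ballE linearZ /= !rnormZ_of ger0_norm ?invr_ge0 ?rnorm_ge0//.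
by rewrite mulVf ?gt_eqF// lexx ler_pdivrMl// mulrC => /(_ isT).
Qed.

Lemma operator_rnorm_le (T : 'L(X, Y)) (M : R) : 0 <= M ->
  (forall x, rnorm (T x) <= M * rnorm x) -> rnorm T <= M.
Proof.
move=> M0 TM; rewrite rnorm_operator; apply: ge_sup.
  exact: (operator_has_sup T).1.
move=> _ [x /= + <-]; rewrite unit_ballE => x1.
by rewrite (le_trans (TM x))// ler_piMr.
Qed.

End operators_extra.

Section dual_extra.
Variables (R : realType) (k : scalar_kind) (V : normedModType (scalars R k)).
Implicit Types (f g : dual V) (x y : V).

Lemma dualZ f c x : f (c *: x) = c * f x :> scalars R k.
Proof. by rewrite linearZ. Qed.

Lemma dual_reD f x y : scalar_re (f (x + y)) = scalar_re (f x) + scalar_re (f y).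
Proof. by rewrite linearD scalar_reD. Qed.

Lemma dual_reB f x y : scalar_re (f (x - y)) = scalar_re (f x) - scalar_re (f y).
Proof. by rewrite linearB scalar_reB. Qed.

Lemma dual_reZ f a x :
  scalar_re (f (scalar_of k a *: x)) = a * scalar_re (f x).
Proof. by rewrite dualZ scalar_reZ. Qed.

Lemma dual_re_le f x : `|scalar_re (f x)| <= rnorm f * rnorm x.
Proof. by rewrite (le_trans (ler_scalar_re _))// ler_rnorm_operator. Qed.

End dual_extra.

Section complexify.
Variables (R : realType) (k : scalar_kind) (V : normedModType (scalars R k)).
Local Notation K := (scalars R k).

(** A complex functional is determined by its real part [u] as
    [u x - i u (i x)]; multiplying [x] by a unimodular scalar that makes the
    value real shows that domination of [u] by a seminorm passes to the
    modulus. *)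
Lemma complexify (u p : V -> R) (C : R) :
  {morph u : x y / x + y} ->
  (forall a x, u (scalar_of k a *: x) = a * u x) ->
  (forall x, u x <= p x) ->
  (forall c x, p (c *: x) <= rnorm (c : K^o) * p x) ->
  (forall x, p x <= C * rnorm x) ->
  exists f : dual V,
    (forall x, scalar_re (f x) = u x) /\ (forall x, rnorm (f x) <= p x).
Proof.
move=> uD uZ up pZ pC.
pose f x : K^o := scalar_of k (u x) - scalar_i * scalar_of k (u (scalar_i *: x)).
have fD x y : f (x + y) = f x + f y.
  by rewrite /f scalerDr !uD !scalar_ofD; ring.
have fZ a x : f (scalar_of k a *: x) = scalar_of k a * f x.
  by rewrite /f scalerA [_ * scalar_of k a]mulrC -scalerA !uZ !scalar_ofM; ring.
have fi x : f (scalar_i *: x) = scalar_i * f x.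
  rewrite /f scalerA; have [i0|i2] := scalar_i_cases R k.
    by rewrite i0 !mul0r subr0 scale0r -[0](scale0r (0 : V)) -scalar_of0 uZ mul0r scalar_of0.
  rewrite i2 mulrBr mulrA i2.
  by rewrite -scalar_of1 -scalar_ofN uZ !scalar_ofM scalar_ofN scalar_of1; ring.
have fl : linear f.
  move=> c x y; rewrite fD; congr (_ + _).
  rewrite {1}[c]scalar_decomp scalerBl fD fZ.
  rewrite -scaleN1r -scalar_of1 -scalar_ofN fZ -scalerA fi fZ.
  by rewrite {3}[c]scalar_decomp scalar_ofN scalar_of1 /GRing.scale/=; ring.
have re_f x : scalar_re (f x) = u x.
  rewrite /f scalar_reB scalar_ofK; have [->|i2] := scalar_i_cases R k.
    by rewrite mul0r scalar_re0 subr0.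
  rewrite [X in _ - X](_ : _ = 0) ?subr0// mulrC scalar_reZ.
  suff -> : scalar_re (scalar_i : K) = 0 by rewrite mulr0.
  by rewrite /scalar_i; case: (k).
have f0 : f 0 = 0.
  have := fZ 0 0; rewrite scalar_of0 scale0r => ->.
  by rewrite mul0r.
have fp x : rnorm (f x) <= p x.
  have [w w1 wf] := scalar_rotate (f x : K).
  have -> : rnorm (f x) = u (w *: x).
    by rewrite -re_f -[w *: x]addr0 fl f0 addr0 [_ *: _]wf scalar_ofK.
  rewrite (le_trans (up _))// (le_trans (pZ _ _))// ler_piMl//.
  have := up x; have := up (- x).
  have -> : u (- x) = - u x.
    by rewrite -scaleN1r -scalar_of1 -scalar_ofN uZ mulN1r.
  have := pZ (- 1) x; rewrite scaleN1r (@rnormN R k K^o).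
  rewrite -[X in rnorm X](scalar_of1 R k) rnorm_scalar_of normr1 mul1r.
  by move=> *; lra.
have [F Ff] := operator_of fl (fun x => le_trans (fp x) (pC x)).
by exists F; split=> x; rewrite Ff.
Qed.

End complexify.

(** * The Hahn-Banach theorem *)

Section hahn_banach.
Variables (R : realType) (k : scalar_kind) (V : normedModType (scalars R k)).
Local Notation K := (scalars R k).
Implicit Types (p q : V -> R) (x y : V).

Definition sublinear q :=
  (forall x y, q (x + y) <= q x + q y) /\
  (forall a x, 0 <= a -> q (scalar_of k a *: x) <= a * q x).

Lemma sublinear0 q : sublinear q -> q 0 = 0.
Proof.
move=> [qD qZ]; apply/eqP; rewrite eq_le; apply/andP; split.
  by have := qZ 0 0 (lexx _); rewrite scaler0 mul0r.
by have := qD 0 0; rewrite addr0; lra.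
Qed.

Lemma sublinearN q x : sublinear q -> - q (- x) <= q x.
Proof.
by move=> sq; have := sq.1 x (- x); rewrite subrr sublinear0//; lra.
Qed.

Lemma inf_sublinear (S : V -> set R) :
  (forall x, S x !=set0) -> (forall x, has_lbound (S x)) ->
  (forall x y v w, S x v -> S y w -> exists2 z, S (x + y) z & z <= v + w) ->
  (forall a x v, 0 <= a -> S x v ->
    exists2 z, S (scalar_of k a *: x) z & z <= a * v) ->
  sublinear (fun x => inf (S x)).
Proof.
move=> S0 Slb SD SZ; split=> [x y|a x a0].
  rewrite -lerBlDr; apply: lb_le_inf => // v Sv.
  rewrite lerBlDl -lerBlDr; apply: lb_le_inf => // w Sw.
  have [z Sz zvw] := SD _ _ _ _ Sv Sw.
  by rewrite lerBlDl (le_trans _ zvw)// ge_inf.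
have infle v : S x v -> inf (S (scalar_of k a *: x)) <= a * v.
  move=> Sv; have [z Sz zav] := SZ _ _ _ a0 Sv.
  by rewrite (le_trans _ zav)// ge_inf.
move: a0; rewrite le_eqVlt => /predU1P[a0|a0].
  by have [v /infle] := S0 x; rewrite -a0 !mul0r.
rewrite -ler_pdivrMl//; apply: lb_le_inf => // v Sv.
by rewrite ler_pdivrMl// infle.
Qed.

(** The largest sublinear minorant of [q] whose value at [- y] is at most
    [- q y]. *)
Definition sublinear_slide q y x : R :=
  inf [set q (x + scalar_of k t *: y) - t * q y | t in [set t | 0 <= t]].

Lemma sublinear_slide_lb q y x : sublinear q ->
  lbound [set q (x + scalar_of k t *: y) - t * q y | t in [set t | 0 <= t]]
    (- q (- x)).
Proof.
move=> sq _ [t /= t0 <-].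
have := sq.1 (x + scalar_of k t *: y) (- x); rewrite addrC addKr => h1.
have [->|tn0] := eqVneq t 0.
  by rewrite scalar_of0 scale0r addr0 mul0r subr0 sublinearN.
have t_gt0 : 0 < t by rewrite lt_neqAle eq_sym tn0.
have := sq.2 t^-1 (scalar_of k t *: y); rewrite invr_ge0 => /(_ t0).
rewrite scalerA -scalar_ofM mulVf// scalar_of1 scale1r.
by rewrite -ler_pdivrMl ?invr_gt0// invrK; lra.
Qed.

Lemma sublinear_slide_le q y t x : sublinear q -> 0 <= t ->
  sublinear_slide q y x <= q (x + scalar_of k t *: y) - t * q y.
Proof.
move=> sq t0; apply: ge_inf; last by exists t.
by exists (- q (- x)); exact: sublinear_slide_lb.
Qed.

Lemma sublinear_slideP q y : sublinear q -> sublinear (sublinear_slide q y).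
Proof.
move=> sq; apply: inf_sublinear.
- by move=> x; exists (q (x + scalar_of k 0 *: y) - 0 * q y), 0 => /=.
- by move=> x; exists (- q (- x)); exact: sublinear_slide_lb.
- move=> x x' _ _ [t /= t0 <-] [t' /= t'0 <-].
  eexists; first by exists (t + t'); [exact: addr_ge0|reflexivity].
  have := sq.1 (x + scalar_of k t *: y) (x' + scalar_of k t' *: y).
  by rewrite addrACA -scalerDl -scalar_ofD; lra.
- move=> a x _ a0 [t /= t0 <-].
  eexists; first by exists (a * t); [exact: mulr_ge0|reflexivity].
  have := sq.2 a (x + scalar_of k t *: y) a0.
  by rewrite scalerDr scalerA -scalar_ofM; lra.
Qed.

(** A decreasing chain of sublinear functionals is bounded below pointwise by
    [- p (- x)], and its infimum is sublinear because of any two members the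
    smaller one can be used at both arguments. *)
Lemma minimal_sublinear p : sublinear p ->
  exists u, [/\ sublinear u, forall x, u x <= p x &
    forall q, sublinear q -> (forall x, q x <= u x) -> q = u].
Proof.
move=> sp; pose T := {q | sublinear q /\ forall x, q x <= p x}.
pose r (s t : T) := `[< forall x, sval t x <= sval s x >].
have [||||[u [su up]] umin] := @Zorn T r.
- by move=> t; apply/asboolP.
- by move=> s t w /asboolP st /asboolP tw; apply/asboolP => x; exact: le_trans (st x).
- move=> [s Ps] [t Pt] /asboolP/= st /asboolP/= ts; apply: eq_exist.
  by apply/funext => x; apply/eqP; rewrite eq_le st ts.
- move=> A Atot; have [[q0 Aq0]|A0] := pselect (A !=set0); last first.
    by exists (exist _ p (conj sp (fun=> lexx _)) : T) => s As; case: A0; exists s.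
  pose S x : set R := [set sval q x | q in A].
  have Slb x : lbound (S x) (- p (- x)).
    move=> _ [[q [sq qp]] _ <-] /=; rewrite (le_trans _ (sublinearN x sq))//.
    by rewrite lerN2.
  have sS : sublinear (fun x => inf (S x)).
    apply: inf_sublinear.
    + by move=> x; exists (sval q0 x), q0.
    + by move=> x; exists (- p (- x)).
    + move=> x y _ _ [q Aq <-] [q' Aq' <-].
      have [/asboolP qq|/asboolP qq] := Atot _ _ Aq Aq'.
        exists (sval q' (x + y)); first by exists q'.
        by rewrite (le_trans ((svalP q').1.1 x y))// lerD2r.
      exists (sval q (x + y)); first by exists q.
      by rewrite (le_trans ((svalP q).1.1 x y))// lerD2l.
    + move=> a x _ a0 [q Aq <-]; exists (sval q (scalar_of k a *: x)).
        by exists q.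
      exact: (svalP q).1.2.
  have Sle (q : T) x : A q -> inf (S x) <= sval q x.
    by move=> Aq; apply: ge_inf; [exists (- p (- x))|exists q].
  have Sp x : inf (S x) <= p x by rewrite (le_trans (Sle q0 x _))// (svalP q0).2.
  exists (exist _ (fun x => inf (S x)) (conj sS Sp) : T) => s As; apply/asboolP => x /=.
  exact: Sle.
- exists u; split=> // q sq qu.
  have qp x : q x <= p x by exact: le_trans (up x).
  have := umin (exist _ q (conj sq qp) : T).
  by move=> /(_ (asboolT qu)) /(congr1 sval).
Qed.

(** By minimality sliding along [y] does not change [u]; this is
    superadditivity. *)
Lemma minimal_sublinear_additive u : sublinear u ->
  (forall q, sublinear q -> (forall x, q x <= u x) -> q = u) ->
  {morph u : x y / x + y}.
Proof.
move=> su umin x y; apply/eqP; rewrite eq_le su.1/=.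
have := sublinear_slide_le y x su ler01.
rewrite scalar_of1 scale1r mul1r lerBrDr.
have -> // : sublinear_slide u y = u.
apply: umin; first exact: sublinear_slideP.
move=> z; have := sublinear_slide_le y z su (lexx 0).
by rewrite scalar_of0 scale0r addr0 mul0r subr0.
Qed.

Lemma additive_sublinear_homogeneous u : sublinear u ->
  {morph u : x y / x + y} -> forall a x, u (scalar_of k a *: x) = a * u x.
Proof.
move=> su uD.
have uN x : u (- x) = - u x.
  by have := uD x (- x); rewrite subrr sublinear0//; lra.
have pos a x : 0 <= a -> u (scalar_of k a *: x) = a * u x.
  move=> a0; apply/eqP; rewrite eq_le su.2//=.
  by have := su.2 a (- x) a0; rewrite scalerN !uN mulrN lerN2.
move=> a x; have [/pos//|a0] := leP 0 a.
have := @pos (- a) x; rewrite oppr_ge0 ltW// => /(_ isT).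
by rewrite scalar_ofN scaleNr uN mulNr => /oppr_inj.
Qed.

(** Minimal sublinear functionals are linear; sliding [p] along [x0] before
    minimizing forces the value [- p x0] at [- x0]. *)
Theorem hahn_banach p (C : R) x0 :
  (forall x y, p (x + y) <= p x + p y) ->
  (forall c x, p (c *: x) <= rnorm (c : K^o) * p x) ->
  (forall x, p x <= C * rnorm x) ->
  exists f : dual V,
    (forall x, rnorm (f x) <= p x) /\ scalar_re (f x0) = p x0.
Proof.
move=> pD pZ pC.
have sp : sublinear p.
  split=> // a x a0.
  by rewrite (le_trans (pZ _ _))// rnorm_scalar_of ger0_norm.
have [u [su us umin]] := minimal_sublinear (sublinear_slideP x0 sp).
have uD := minimal_sublinear_additive su umin.
have uZ := additive_sublinear_homogeneous su uD.
have up x : u x <= p x.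
  rewrite (le_trans (us x))//.
  have := sublinear_slide_le x0 x sp (lexx 0).
  by rewrite scalar_of0 scale0r addr0 mul0r subr0.
have [f [re_f fp]] := complexify uD uZ up pZ pC.
exists f; split=> //; rewrite re_f; apply/eqP; rewrite eq_le up/=.
have := le_trans (us (- x0)) (sublinear_slide_le x0 (- x0) sp ler01).
rewrite scalar_of1 scale1r addNr sublinear0// mul1r sub0r.
have -> : u (- x0) = - u x0.
  by have := uD x0 (- x0); rewrite subrr sublinear0//; lra.
by rewrite lerN2.
Qed.

End hahn_banach.

Lemma norming_functional (R : realType) (k : scalar_kind)
    (V : normedModType (scalars R k)) (x : V) :
  exists f : dual V,
    (forall y, rnorm (f y) <= rnorm y) /\ scalar_re (f x) = rnorm x.
Proof.
apply: (@hahn_banach R k V (@rnorm R k V) 1).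
- exact: ler_rnormD.
- by move=> c y; rewrite (rnormZ (c : (scalars R k)^o)).
- by move=> y; rewrite mul1r.
Qed.

(** * Limits along an ultrafilter *)

Lemma ultra_cvg (R : realType) (G : set_system nat) (a : nat -> R) (M : R) :
  UltraFilter G -> (forall n, `|a n| <= M) -> exists l : R, a @ G --> l.
Proof.
move=> GU aM.
have GM : (a @ G) `[- M, M]%classic.
  by rewrite /fmap/=; apply: filterE => n; rewrite /= in_itv/= -ler_norml aM.
have [l [_ cl]] := @segment_compact R (- M) M (a @ G) _ GM.
exists l => N Nl; have [//|GN] := in_ultra_setVsetC (a @^-1` N) GU.
by have [z []] := cl (~` N) N GN Nl.
Qed.

Section ultralimit.
Variables (R : realType) (k : scalar_kind) (V : normedModType (scalars R k)).

(** Bounded real sequences converge along an ultrafilter, and a pointwise limit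
    of uniformly bounded functionals is again linear and bounded: this is the
    theorem of Banach and Alaoglu, stated without the weak* topology. *)
Lemma ultralimit_functional (G : set_system nat) (F : nat -> dual V) (C : R) :
  UltraFilter G -> (forall n, rnorm (F n) <= C) ->
  exists f : dual V, forall v,
    scalar_re (F n v) @[n --> G] --> scalar_re (f v).
Proof.
move=> GU FC.
have Fb n v : `|scalar_re (F n v)| <= C * rnorm v.
  rewrite (le_trans (dual_re_le _ _))//.
  by rewrite ler_wpM2r// rnorm_ge0.
have /choice[u uP] v : exists l : R, scalar_re (F n v) @[n --> G] --> l.
  exact: (ultra_cvg GU (Fb^~ v)).
have uE v l : scalar_re (F n v) @[n --> G] --> l -> u v = l.
  by move=> /(cvg_lim (@Rhausdorff R)) <-; apply/esym/(cvg_lim (@Rhausdorff R)).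
have [|||||f [fu _]] := @complexify R k V u (fun v => C * rnorm v) C.
- move=> x y; apply: uE; under eq_fun do rewrite dual_reD.
  by apply: cvgD; exact: uP.
- move=> a x; apply: uE.
  under eq_fun do rewrite dual_reZ.
  by apply: cvgMr; exact: uP.
- move=> x; have /(cvg_lim (@Rhausdorff R)) <- := uP x.
  apply: limr_le; first by apply/cvg_ex; exists (u x); exact: uP.
  apply: filterE => n.
  by rewrite (le_trans _ (Fb n x))// ler_norm.
- move=> c x; rewrite (rnormZ (c : (scalars R k)^o)) mulrCA.
  by [].
- by [].
by exists f => v; rewrite fu; exact: uP.
Qed.

End ultralimit.

Section weak_convergence.
Variables (R : realType) (k : scalar_kind) (X : normedModType (scalars R k)).
Local Notation K := (scalars R k).

Lemma scalar_cvg0P (T : Type) (z : T -> K^o) (F : set_system T) : Filter F ->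
  z @ F --> (0 : K^o) <->
  forall e : R, 0 < e -> \forall n \near F, rnorm (z n) < e.
Proof.
move=> FF; rewrite cvgr0Pnorm_lt; split=> z0 e e0.
  have := z0 (scalar_of k e); rewrite -scalar_of0 ltr_scalar_of => /(_ e0).
  by apply: filterS => n; rewrite rnormE ltr_scalar_of.
have e_re : scalar_of k (scalar_re e) = e by rewrite scalar_reK// ltW.
have re0 : 0 < scalar_re e by rewrite -(ltr_scalar_of k) scalar_of0 e_re.
by apply: filterS (z0 _ re0) => n; rewrite rnormE => h; rewrite -e_re ltr_scalar_of.
Qed.

(** The imaginary part of [f x] is, up to sign, the real part of [(i f) x]. *)
Lemma weakly_nullP (x : nat -> X) :
  weakly_null x <->
  forall f : dual X, scalar_re (f (x n)) @[n --> \oo] --> (0 : R).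
Proof.
split=> wx f.
  apply/cvgr0Pnorm_lt => e e0.
  apply: filterS ((scalar_cvg0P _ _).1 (wx f) e e0) => n.
  exact/le_lt_trans/ler_scalar_re.
apply/scalar_cvg0P => e e0; have e2 : 0 < e / 2 by lra.
have h1 := (cvgr0Pnorm_lt _).1 (wx f) _ e2.
have h2 := (cvgr0Pnorm_lt _).1 (wx (scalar_i *: f)) _ e2.
near=> n.
rewrite [f (x n)]scalar_decomp (le_lt_trans (ler_rnormD _ _))//.
rewrite (@rnormN R k K^o) rnormM !rnorm_scalar_of.
have : `|scalar_re (f (x n))| < e / 2 by near: n; exact: h1.
have : `|scalar_re ((scalar_i *: f) (x n))| < e / 2 by near: n; exact: h2.
rewrite [(_ *: f) _]/(scalar_i * f (x n)).
have := rnorm_scalar_i R k; have := @rnorm_ge0 R k (K^o) scalar_i.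
by nra.
Unshelve. all: by end_near. Qed.

Lemma weakly_null_sub (x : nat -> X) (phi : nat -> nat) :
  (forall n, (n <= phi n)%N) -> weakly_null x -> weakly_null (x \o phi).
Proof.
move=> le_phi wx f; apply: cvg_comp (wx f) => A [N _ NA]; exists N => // n /= Nn.
by apply: NA => /=; exact: leq_trans (le_phi n).
Qed.

End weak_convergence.

(** * Weakly null sequences are bounded *)

Lemma nat_ultrafilter : exists G : set_system nat, UltraFilter G /\ \oo `<=` G.
Proof. exact: ultraFilterLemma. Qed.

Section uniform_boundedness.
Variables (R : realType) (k : scalar_kind) (X : normedModType (scalars R k)).
Local Notation K := (scalars R k).

(** A gliding hump: to the sum of the earlier terms add a multiple of a
    functional norming [y n], with the sign that does not decrease the
    modulus of the value at [y n]. *)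
Fixpoint hump_sum (g : nat -> dual X) (y : nat -> X) (n : nat) : dual X :=
  if n is m.+1 then
    hump_sum g y m + scalar_of k
      ((if 0 <= scalar_re (hump_sum g y m (y m)) then 1 else -1) * 3^-1 ^+ m)
      *: g m
  else 0.

Variables (g : nat -> dual X) (y : nat -> X).
Hypothesis g1 : forall n, rnorm (g n) <= 1.
Hypothesis gy : forall n, scalar_re (g n (y n)) = rnorm (y n).
Local Notation F := (hump_sum g y).

Lemma hump_sum_step n v : exists2 s : R, `|s| = 3^-1 ^+ n &
  scalar_re (F n.+1 v) = scalar_re (F n v) + s * scalar_re (g n v).
Proof.
rewrite /=; set s := (X in scalar_of k X); exists s.
  rewrite /s normrM [X in _ * X]ger0_norm ?exprn_ge0 ?invr_ge0//.
  by case: ifP; rewrite ?normrN normr1 mul1r.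
by rewrite -scalar_reZ -scalar_reD.
Qed.

Lemma hump_sum_bounded n : rnorm (F n) <= 2.
Proof.
suff h : rnorm (F n) <= 3 / 2 * (1 - 3^-1 ^+ n).
  have : 0 <= 3^-1 ^+ n :> R by rewrite exprn_ge0 ?invr_ge0.
  by lra.
elim: n => [|n IH] /=; first by rewrite rnorm0 expr0 subrr mulr0.
rewrite (le_trans (ler_rnormD _ _))// rnormZ_of normrM.
have e0 : 0 <= 3^-1 ^+ n :> R by rewrite exprn_ge0 ?invr_ge0.
rewrite [`|_ ^+ n|]ger0_norm// exprS.
have -> : `|if 0 <= scalar_re (F n (y n)) then 1 else -1 : R| = 1.
  by case: ifP; rewrite ?normrN normr1.
have := g1 n; have := rnorm_ge0 (g n).
by nra.
Qed.

Lemma hump_sum_tail n m v :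
  `|scalar_re (F (n.+1 + m)%N v) - scalar_re (F n.+1 v)| <=
  (3^-1 ^+ n - 3^-1 ^+ (n + m)) / 2 * rnorm v.
Proof.
elim: m => [|m IH]; first by rewrite !addn0 !subrr normr0 mul0r mul0r.
rewrite !addnS.
have [s sE ->] := hump_sum_step (n.+1 + m) v.
have gv := dual_re_le (g (n.+1 + m)%N) v.
have gv1 : `|scalar_re (g (n.+1 + m)%N v)| <= rnorm v.
  by rewrite (le_trans gv)// ler_piMl// rnorm_ge0.
rewrite addrAC (le_trans (ler_normD _ _))// normrM sE.
have e0 : 0 <= 3^-1 ^+ (n + m) :> R by rewrite exprn_ge0 ?invr_ge0.
rewrite addSn !exprS; move: IH; rewrite -/(F _).
have : 3^-1 * 3^-1 ^+ (n + m) * `|scalar_re (g (n.+1 + m)%N v)| <=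
       3^-1 * 3^-1 ^+ (n + m) * rnorm v.
  by apply: ler_wpM2l => //; rewrite mulr_ge0// invr_ge0.
rewrite addSn /=.
by lra.
Qed.

Lemma hump_sum_at n :
  3^-1 ^+ n * rnorm (y n) <= `|scalar_re (F n.+1 (y n))|.
Proof.
rewrite /= [X in scalar_re X](_ : _ = F n (y n) +
   scalar_of k ((if 0 <= scalar_re (F n (y n)) then 1 else -1) * 3^-1 ^+ n)
   * g n (y n))//.
rewrite scalar_reD scalar_reZ gy.
have e0 : 0 <= 3^-1 ^+ n :> R by rewrite exprn_ge0 ?invr_ge0.
have := mulr_ge0 e0 (rnorm_ge0 (y n)).
have [h|h] := leP 0 (scalar_re (F n (y n))).
  by move=> *; rewrite ger0_norm; lra.
by move=> *; rewrite ler0_norm; lra.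
Qed.

(** The ratio [1/3] makes all later steps together change the value at [y n] by
    at most half of what step [n] guarantees there. *)
Lemma hump_functional :
  exists f : dual X, forall n, 3^-1 ^+ n / 2 * rnorm (y n) <= `|scalar_re (f (y n))|.
Proof.
have [G [GU ooG]] := nat_ultrafilter.
have [f fF] := ultralimit_functional GU hump_sum_bounded.
exists f => n.
have tail : `|scalar_re (f (y n)) - scalar_re (F n.+1 (y n))| <=
    3^-1 ^+ n / 2 * rnorm (y n).
  have cv : `|scalar_re (F m (y n)) - scalar_re (F n.+1 (y n))| @[m --> G] -->
      `|scalar_re (f (y n)) - scalar_re (F n.+1 (y n))|.
    by apply: cvg_norm; apply: cvgB; [exact: fF|exact: cvg_cst].
  rewrite -(cvg_lim (@Rhausdorff R) cv); apply: limr_le.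
    by apply/cvg_ex; eexists; exact: cv.
  apply: ooG; exists n.+1 => // m /= nm.
  have := hump_sum_tail n (m - n.+1) (y n); rewrite subnKC// => /le_trans; apply.
  apply: ler_wpM2r; first exact: rnorm_ge0.
  have : 0 <= 3^-1 ^+ (n + (m - n.+1)) :> R by rewrite exprn_ge0 ?invr_ge0.
  by lra.
have := hump_sum_at n.
have := ler_normB (scalar_re (f (y n)))
  (scalar_re (f (y n)) - scalar_re (F n.+1 (y n))).
rewrite opprB addrCA subrr addr0.
by lra.
Qed.

End uniform_boundedness.

(** Along a subsequence of an unbounded sequence whose norms exceed [2 * 3 ^+ n],
    the hump functional takes values of modulus at least [1]. *)
Lemma weakly_null_bounded (R : realType) (k : scalar_kind)
    (X : normedModType (scalars R k)) (x : nat -> X) :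
  weakly_null x -> exists C, forall n, rnorm (x n) <= C.
Proof.
move=> /weakly_nullP wx; apply: contrapT => nb.
have unb n : exists m, (n <= m)%N /\ 2 * 3 ^+ n < rnorm (x m).
  apply: contrapT => h; apply: nb.
  (* the sum takes care of the finitely many terms before the n-th *)
  exists (2 * 3 ^+ n + \sum_(i < n) rnorm (x i)) => m.
  have [nm|mn] := leqP n m.
    have [h2|h2] := leP (rnorm (x m)) (2 * 3 ^+ n).
      by rewrite (le_trans h2)// lerDl sumr_ge0// => i _; exact: rnorm_ge0.
    by case: h; exists m.
  rewrite (bigD1 (Ordinal mn))//= addrCA lerDl addr_ge0//.
  by rewrite sumr_ge0// => i _; exact: rnorm_ge0.
have /choice[phi phiP] := unb.
have /choice[g gP] n := norming_functional (x (phi n)).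
have g1 n : rnorm (g n) <= 1.
  by apply: operator_rnorm_le => // v; rewrite mul1r (gP n).1.
have [f fP] := hump_functional g1 (fun n => (gP n).2).
have : \forall n \near \oo, `|scalar_re (f (x n))| < 1.
  exact: (cvgr0Pnorm_lt _).1 (wx f) _ ltr01.
move=> [N _ /(_ _ (phiP N).1)/=]; apply/negP; rewrite -leNgt.
apply: le_trans (fP N).
have := (phiP N).2; rewrite exprVn.
have e0 : 0 < 3 ^+ N :> R by rewrite exprn_gt0.
move=> h; rewrite -mulrA ler_pdivlMl// mulr1.
by lra.
Qed.

(** * Weak sequential compactness in reflexive spaces *)

Section closed_span.
Variables (R : realType) (k : scalar_kind) (X : normedModType (scalars R k)).
Local Notation K := (scalars R k).
Implicit Types (x : nat -> X) (s t : seq K).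

Fixpoint lin_comb x s : X :=
  if s is c :: t then c *: x 0%N + lin_comb (fun n => x n.+1) t else 0.

Lemma lin_combD x s t : exists r, lin_comb x r = lin_comb x s + lin_comb x t.
Proof.
elim: s t x => [|c s IH] [|d t] x /=.
- by exists [::]; rewrite addr0.
- by exists (d :: t); rewrite add0r.
- by exists (c :: s); rewrite addr0.
- have [r rE] := IH t (fun n => x n.+1).
  by exists (c + d :: r); rewrite /= rE scalerDl addrACA.
Qed.

Lemma lin_combZ x (c : K) s : lin_comb x [seq c * a | a <- s] = c *: lin_comb x s.
Proof.
by elim: s x => [|a s IH] x /=; rewrite ?scaler0// IH scalerDr scalerA.
Qed.

Lemma lin_comb_delta x n : exists s, lin_comb x s = x n.
Proof.
elim: n x => [|n IH] x; first by exists [:: 1]; rewrite /= scale1r addr0.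
by have [s sE] := IH (fun n => x n.+1); exists (0 :: s); rewrite /= scale0r add0r.
Qed.

Definition rat_scalar (q : rat * rat) : K :=
  scalar_of k (ratr q.1) + scalar_i * scalar_of k (ratr q.2).

Lemma lin_comb_rat x s (e : R) : 0 < e -> exists t : seq (rat * rat),
  rnorm (lin_comb x s - lin_comb x (map rat_scalar t)) < e.
Proof.
elim: s x e => [|c s IH] x e e0; first by exists [::]; rewrite subrr rnorm0.
have e2 : 0 < e / 2 by lra.
have [t tP] := IH (fun n => x n.+1) _ e2.
have n0 := rnorm_ge0 (x 0%N).
have [|q qP] := scalar_rat_approx c (e := e / 2 / (rnorm (x 0%N) + 1)).
  by rewrite divr_gt0//; lra.
exists (q :: t); rewrite /= opprD addrACA -scalerBl.
rewrite (le_lt_trans (ler_rnormD _ _))// (splitr e) ler_ltD//.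
rewrite (rnormZ (c - rat_scalar q : K^o)).
move: (ltW qP); rewrite ler_pdivlMr; last by lra.
have := @rnorm_ge0 R k (K^o) (c - rat_scalar q).
by nra.
Qed.

Definition span_dist x v : R := inf [set rnorm (v - lin_comb x s) | s in setT].

Lemma span_dist_le x v s : span_dist x v <= rnorm (v - lin_comb x s).
Proof.
by apply: ge_inf; [exists 0 => _ [t _ <-]; exact: rnorm_ge0|exists s].
Qed.

Lemma span_distD x u v : span_dist x (u + v) <= span_dist x u + span_dist x v.
Proof.
have [|||| + _] := @inf_sublinear R k X
  (fun v => [set rnorm (v - lin_comb x s) | s in setT]); last exact.
- by move=> w; exists (rnorm (w - lin_comb x [::])), [::].
- by move=> w; exists 0 => _ [t _ <-]; exact: rnorm_ge0.
- move=> w w' _ _ [s _ <-] [t _ <-]; have [r rE] := lin_combD x s t.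
  exists (rnorm (w + w' - lin_comb x r)); first by exists r.
  by rewrite rE opprD addrACA ler_rnormD.
- move=> a w _ a0 [s _ <-]; eexists; first by exists [seq scalar_of k a * b | b <- s].
  by rewrite lin_combZ -scalerBr rnormZ_of ger0_norm.
Qed.

Lemma span_distZ x (c : K) v : span_dist x (c *: v) <= rnorm (c : K^o) * span_dist x v.
Proof.
have le_s s : span_dist x (c *: v) <= rnorm (c : K^o) * rnorm (v - lin_comb x s).
  rewrite (le_trans (span_dist_le _ _ [seq c * a | a <- s]))//.
  by rewrite lin_combZ -scalerBr (rnormZ (c : K^o)).
have := @rnorm_ge0 R k (K^o) c; rewrite le_eqVlt => /predU1P[c0|c0].
  by have := le_s [::]; rewrite -c0 !mul0r.
rewrite -ler_pdivrMl//; apply: lb_le_inf; first by exists (rnorm (v - lin_comb x [::])), [::].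
by move=> _ [s _ <-]; rewrite ler_pdivrMl.
Qed.

(** By the Hahn-Banach theorem applied to the distance to the span, the double
    annihilator is the closed span. Functionals that norm the rational
    combinations therefore separate its points. *)
Lemma countable_separation x : exists D : nat -> dual X, forall v,
  (forall f : dual X, (forall n, f (x n) = 0) -> scalar_re (f v) = 0) ->
  (forall j, scalar_re (D j v) = 0) -> v = 0.
Proof.
have /choice[N NP] (t : seq (rat * rat)) :=
  norming_functional (lin_comb x (map rat_scalar t)).
exists (fun j => if unpickle j is Some t then N t else 0) => v annv Dv.
have {annv} dist0 : span_dist x v = 0.
  have [||v'|f [fp <-]] := @hahn_banach R k X (span_dist x) 1 v.
  - exact: span_distD.
  - exact: span_distZ.
  - by rewrite (le_trans (span_dist_le _ _ [::]))//= subr0 mul1r.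
  apply: annv => n; apply: (@rnorm_eq0 R k (K^o)); apply/eqP.
  rewrite eq_le rnorm_ge0 andbT (le_trans (fp _))//.
  have [s sE] := lin_comb_delta x n.
  by rewrite (le_trans (span_dist_le _ _ s))// sE subrr rnorm0.
apply: contrapT => /eqP/rnorm_gt0 v0.
have [||_ [s _ <-]] := @inf_lt R [set rnorm (v - lin_comb x s) | s in setT] (rnorm v / 4).
- by exists (rnorm (v - lin_comb x [::])), [::].
- by rewrite -/(span_dist x v) dist0; lra.
move=> hs; have [|t tP] := @lin_comb_rat x s (rnorm v / 4); first by lra.
have dt : rnorm (v - lin_comb x (map rat_scalar t)) < rnorm v / 2.
  rewrite -(subrK (lin_comb x s) v) -addrA (le_lt_trans (ler_rnormD _ _))//.
  by rewrite subrK; lra.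
have := Dv (pickle t); rewrite pickleK => Nv.
have := (NP t).2.
have := ler_scalar_re (N t (lin_comb x (map rat_scalar t) - v)).
rewrite dual_reB Nv subr0 => h1.
have h2 := (NP t).1 (lin_comb x (map rat_scalar t) - v).
have h3 := ler_rnormB v (lin_comb x (map rat_scalar t)).
have h4 := ler_norm (scalar_re (N t (lin_comb x (map rat_scalar t)))).
have h5 : rnorm (lin_comb x (map rat_scalar t) - v) = rnorm (v - lin_comb x (map rat_scalar t)).
  by rewrite -rnormN opprB.
by rewrite h5 in h2; lra.
Qed.

End closed_span.

Section weak_compactness.
Variables (R : realType) (k : scalar_kind) (X : normedModType (scalars R k)).
Hypothesis reflX : reflexive_space X.

(** The terms of the sequence act on the dual as bounded functionals;
    reflexivity turns their limit along the ultrafilter into a point. *)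
Lemma ultralimit_point (G : set_system nat) (x : nat -> X) (C : R) :
  UltraFilter G -> (forall n, rnorm (x n) <= C) ->
  exists z : X, forall f : dual X,
    scalar_re (f (x n)) @[n --> G] --> scalar_re (f z).
Proof.
move=> GU xC.
have /choice[ev evP] n : exists e : dual (dual X), forall f, e f = f (x n).
  apply: (@operator_of R k (dual X) _ (fun f : dual X => f (x n)) C).
    by move=> c f g.
  by move=> f; rewrite (le_trans (ler_rnorm_operator _ _))// mulrC ler_wpM2r ?rnorm_ge0.
have evC n : rnorm (ev n) <= C.
  apply: operator_rnorm_le; first by rewrite (le_trans _ (xC n))// rnorm_ge0.
  move=> f; rewrite evP (le_trans (ler_rnorm_operator _ _))// mulrC.
  by rewrite ler_wpM2r ?rnorm_ge0.
have [F FP] := ultralimit_functional GU evC.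
have [z zP] := reflX F; exists z => f.
by have := FP f; rewrite zP; under eq_fun do rewrite evP.
Qed.

(** The diagonal subsequence converges to the ultralimit [z] on the countable
    family [D]. Every other cluster point agrees with [z] on [D], and both
    lie in the closed span, on which [D] separates points; so the whole
    subsequence converges weakly. *)
Theorem weakly_convergent_subsequence (x : nat -> X) (C : R) :
  (forall n, rnorm (x n) <= C) ->
  exists (phi : nat -> nat) (z : X), (forall n, (n <= phi n)%N) /\
    weakly_null (fun n => x (phi n) - z).
Proof.
move=> xC; have [G [GU ooG]] := nat_ultrafilter.
have [z zP] := ultralimit_point GU xC.
have [D DP] := countable_separation x.
have /choice[phi phiP] n : exists m, (n <= m)%N /\
    forall j, (j <= n)%N -> `|scalar_re (D j (x m - z))| < n.+1%:R^-1.
  have /filter_ex[m [nm mP]] : G [set m | (n <= m)%N /\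
      forall j, (j <= n)%N -> `|scalar_re (D j (x m - z))| < n.+1%:R^-1].
    apply: filterI; first by apply: ooG; exists n.
    (* the filter is closed under finite intersections only, hence the
       induction on the bound for [j], the threshold [n.+1%:R^-1] staying fixed *)
    elim: {1}n => [|i IH].
      have := (cvgrPdist_lt _ _).1 (zP (D 0%N)) n.+1%:R^-1; rewrite invr_gt0 ltr0n.
      move=> /(_ _ isT); apply: filterS => m h [|//] _.
      by rewrite dual_reB distrC.
    have := (cvgrPdist_lt _ _).1 (zP (D i.+1)) n.+1%:R^-1; rewrite invr_gt0 ltr0n.
    move=> /(_ _ isT); apply: filterS2 IH => m h1 h2 j.
    rewrite leq_eqVlt => /predU1P[->|]; last exact: h1.
    by rewrite dual_reB distrC.
  by exists m.
exists phi, z; split; first by move=> n; exact: (phiP n).1.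
apply/weakly_nullP => f; apply: contrapT => nf.
have [e e0 /choice[psi psiP]] : exists2 e : R, 0 < e &
    forall n, exists m, (n <= m)%N /\ e <= `|scalar_re (f (x (phi m) - z))|.
  apply: contrapT => h; apply: nf; apply/cvgr0Pnorm_lt => e e0.
  apply: contrapT => he; apply: h; exists e => // n.
  apply: contrapT => hn; apply: he; exists n => // m /= nm.
  by rewrite ltNge; apply/negP => hm; apply: hn; exists m.
have [w wP] := ultralimit_point GU (fun n => xC (phi (psi n))).
(* [w] is a cluster point at which [f] differs from its value at [z] *)
suff wz : w - z = 0.
  have : `|scalar_re (f (x (phi (psi n)) - z))| @[n --> G] --> `|scalar_re (f (w - z))|.
    under eq_fun do rewrite dual_reB.
    by rewrite dual_reB; apply: cvg_norm; apply: cvgB; [exact: wP|exact: cvg_cst].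
  rewrite wz linear0 scalar_re0 normr0 => cv.
  have := limr_ge (x := e) (cvgP _ cv); rewrite (cvg_lim (@Rhausdorff R) cv).
  have /[swap]/[apply] : \forall n \near G, e <= `|scalar_re (f (x (phi (psi n)) - z))|.
    by apply: filterE => n; exact: (psiP n).2.
  by rewrite leNgt e0.
apply: DP => [h hx|j].
  have z0 (u : X) (rho : nat -> nat) :
      (scalar_re (h (x (rho n))) @[n --> G] --> scalar_re (h u)) -> scalar_re (h u) = 0.
    under eq_fun do rewrite hx scalar_re0.
    by move=> /(cvg_lim (@Rhausdorff R)) <-; apply: (cvg_lim (@Rhausdorff R)); exact: cvg_cst.
  by rewrite dual_reB (z0 w _ (wP h)) (z0 z id (zP h)) subrr.
have cv : scalar_re (D j (x (phi (psi n)) - z)) @[n --> \oo] --> (0 : R).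
  apply/cvgr0Pnorm_lt => e' e'0; near=> n.
  have jn : (j <= psi n)%N.
    by rewrite (leq_trans _ (psiP n).1)//; near: n; exists j.
  rewrite (lt_le_trans ((phiP (psi n)).2 j jn))//.
  rewrite -[leRHS]invrK lef_pV2 ?posrE ?invr_gt0//.
  rewrite (le_trans (ltW (truncnS_gt _)))// ler_nat ltnS.
  by rewrite (leq_trans _ (psiP n).1)//; near: n; exists (Num.truncn e'^-1).
have cvG : scalar_re (D j (x (phi (psi n)) - z)) @[n --> G] --> (0 : R).
  by move=> A /cv; exact: ooG.
have cvG' : scalar_re (D j (x (phi (psi n)) - z)) @[n --> G] --> scalar_re (D j (w - z)).
  under eq_fun do rewrite dual_reB.
  by rewrite dual_reB; apply: cvgB; [exact: wP|exact: cvg_cst].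
by rewrite -(cvg_lim (@Rhausdorff R) cvG') (cvg_lim (@Rhausdorff R) cvG).
Unshelve. all: by end_near. Qed.

End weak_compactness.

(** * Upper limits *)

Section upper_limits.
Variable R : realType.
Implicit Types (a : nat -> R) (r : R).

Lemma limn_esup_lt a r : (limn_esup (fun n => (a n)%:E) < r%:E)%E ->
  \forall n \near \oo, a n < r.
Proof.
move=> /ereal_inf_lt[_ [V Voo <-] Vr]; apply: filterS Voo => n Vn.
by rewrite -lte_fin (le_lt_trans _ Vr)//; apply: ereal_sup_ubound; exists n.
Qed.

Lemma limn_esup_gt a r N : (r%:E < limn_esup (fun n => (a n)%:E))%E ->
  exists n, (N <= n)%N /\ r < a n.
Proof.
move=> ra; have /ereal_sup_gt[_ [n Nn <-]] :
    (r%:E < ereal_sup [set (a n)%:E | n in [set n | (N <= n)%N]])%E.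
  apply: lt_le_trans ra _; apply: ereal_inf_lbound.
  by exists [set n | (N <= n)%N] => //; exists N.
by rewrite lte_fin => rn; exists n.
Qed.

Lemma limn_esup_le a r : (forall n, a n <= r) ->
  (limn_esup (fun n => (a n)%:E) <= r%:E)%E.
Proof.
move=> ar; apply: (@le_trans _ _ (ereal_sup [set (a n)%:E | n in setT])).
  by apply: ereal_inf_lbound; exists setT => //; exact: filterT.
by apply: ge_ereal_sup => _ [n _ <-]; rewrite lee_fin.
Qed.

Lemma limn_esup_fin_num a M : (forall n, 0 <= a n <= M) ->
  limn_esup (fun n => (a n)%:E) \is a fin_num.
Proof.
move=> aM; rewrite fin_numElt (@lt_le_trans _ _ 0%E)//=.
  by rewrite (le_lt_trans (@limn_esup_le a M _)) ?ltry// => n; case/andP: (aM n).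
apply: le_ereal_inf_tmp => _ [V [N _ NV] <-].
apply: (@le_trans _ _ (a N)%:E); first by rewrite lee_fin; case/andP: (aM N).
by apply: ereal_sup_ubound; exists N => //; exact: NV (leqnn N).
Qed.

End upper_limits.

(** * Coordinates in the space of null sequences *)

Section c0_coordinates.
Variables (R : realType) (k : scalar_kind).
Local Notation K := (scalars R k).
Local Notation c0 := (c0 R k).
Implicit Types (u v : c0).

Lemma rnorm_c0 u : rnorm u = c0_rnorm u.
Proof. by rewrite /rnorm [`|u|]/(c0_norm u) scalar_ofK. Qed.

Lemma c0_coordD u v n : (u + v) n = u n + v n.
Proof. by []. Qed.

Lemma c0_coordZ (c : K) u n : (c *: u) n = c * u n :> K.
Proof. by []. Qed.

Lemma c0_coord_le u n : rnorm (u n) <= rnorm u.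
Proof. by rewrite rnorm_c0 c0_rnorm_ub. Qed.

Lemma c0_near u (e : R) : 0 < e -> exists N, forall n, (N <= n)%N -> rnorm (u n) < e.
Proof.
move=> e0; have /asboolP/scalar_cvg0P/(_ _ e0)[N _ uN] := c0_subproof u.
by exists N => n Nn; exact: uN.
Qed.

(** The supremum defining the norm is a maximum, since all but finitely many
    coordinates are below half of it. *)
Lemma c0_norm_attained u : exists n, rnorm (u n) = rnorm u.
Proof.
apply: contrapT => na.
have lt_u n : rnorm (u n) < rnorm u.
  rewrite lt_neqAle c0_coord_le andbT.
  by apply/negP => /eqP h; apply: na; exists n.
have u0 : 0 < rnorm u by rewrite (le_lt_trans _ (lt_u 0%N))// rnorm_ge0.
have [|N uN] := @c0_near u (rnorm u / 2); first by lra.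
have [s su sP] : exists2 s, s < rnorm u & forall n, (n < N)%N -> rnorm (u n) <= s.
  elim: N {uN} => [|N [s su sP]]; first by exists 0.
  exists (Num.max s (rnorm (u N))); first by rewrite gt_max su lt_u.
  move=> n; rewrite ltnS leq_eqVlt => /predU1P[->|/sP h]; rewrite le_max ?lexx ?orbT//.
  by rewrite h.
suff : rnorm u <= Num.max s (rnorm u / 2).
  by rewrite leNgt gt_max su/= => /negP; apply; lra.
rewrite {1}rnorm_c0; apply: ge_sup; first exact: (c0_has_sup u).1.
move=> _ [n _ <-]; rewrite le_max; have [/sP -> //|/uN/ltW ->] := ltnP n N.
by rewrite orbT.
Qed.

Variable X : normedModType K.

Lemma c0_coord_functional (T : 'L(X, c0)) n :
  exists f : dual X, forall x, f x = T x n.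
Proof.
apply: (@operator_of R k X (K^o) (fun x => T x n) (rnorm T)).
  by move=> c x y; rewrite linearD linearZ.
by move=> x; rewrite (le_trans (c0_coord_le _ _))// ler_rnorm_operator.
Qed.

(** Indices that escape to infinity keep the values null sequences; factors
    below [1] but tending to [1] keep every coordinate functional away from the
    norm of [T] while its supremum may still reach it. *)
Lemma shrunk_coordinates (T : 'L(X, c0)) (m : nat -> nat) :
  (forall j, (j <= m j)%N) ->
  exists S : 'L(X, c0), forall z j,
    S z j = scalar_of k (1 - j.+1%:R^-1) * T z (m j) :> K.
Proof.
move=> le_m; pose s z : nat -> K^o := fun j => scalar_of k (1 - j.+1%:R^-1) * T z (m j).
have c1 (j : nat) : `|1 - j.+1%:R^-1 : R| <= 1.
  have : j.+1%:R^-1 <= 1 :> R by rewrite invf_le1 ?ltr0n// ler1n.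
  have : 0 <= j.+1%:R^-1 :> R by rewrite invr_ge0.
  by move: (j.+1%:R^-1) => t *; rewrite ger0_norm; lra.
have sT z j : rnorm (s z j) <= rnorm (T z (m j)).
  by rewrite /s rnormM rnorm_scalar_of ler_piMl// rnorm_ge0.
have s0 z : s z \in is_null_seq (k := k).
  apply/asboolP/scalar_cvg0P => e e0; have [N TN] := c0_near (T z) e0.
  exists N => // j /= Nj; rewrite (le_lt_trans (sT z j))// TN//.
  exact: leq_trans (le_m j).
have [||S SP] := @operator_of R k X c0 (fun z => NullSeq (s0 z)) (rnorm T).
- move=> c z w; apply/val_inj/funext => j /=.
  rewrite [RHS]/(c * s z j + s w j) /s linearD linearZ c0_coordD c0_coordZ.
  by rewrite mulrDr mulrCA.
- move=> z; have [j <-] := c0_norm_attained (NullSeq (s0 z)).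
  by rewrite (le_trans (sT z j))// (le_trans (c0_coord_le _ _))// ler_rnorm_operator.
by exists S => z j; rewrite SP.
Qed.

End c0_coordinates.

(** * The weak maximizing property and property strict (M) *)

Section maximizing.
Variables (R : realType) (k : scalar_kind) (X Y : normedModType (scalars R k)).
Local Notation K := (scalars R k).

Lemma maximizing_sequenceP (T : 'L(X, Y)) (x : nat -> X) :
  maximizing_sequence T x <->
  (forall n, rnorm (x n) <= 1) /\ rnorm (T (x n)) @[n --> \oo] --> rnorm T.
Proof.
have cvE : (`|T (x n)| @[n --> \oo] --> (`|T| : K^o)) <->
    rnorm (T (x n)) @[n --> \oo] --> rnorm T.
  have dist n : rnorm (`|T| - `|T (x n)| : K^o) = `|rnorm T - rnorm (T (x n))|.
    by rewrite !rnormE -scalar_ofN -scalar_ofD rnorm_scalar_of.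
  split=> [/cvgrPdist_lt Tx|/cvgrPdist_lt Tx]; apply/cvgrPdist_lt => e e0.
    have := Tx (scalar_of k e); rewrite -scalar_of0 ltr_scalar_of => /(_ e0).
    apply: filterS => n.
    by rewrite (@rnormE R k K^o (`|T| - `|T (x n)|)) dist ltr_scalar_of.
  have e_re : scalar_of k (scalar_re e) = e by rewrite scalar_reK// ltW.
  have re0 : 0 < scalar_re e by rewrite -(ltr_scalar_of k) scalar_of0 e_re.
  apply: filterS (Tx _ re0) => n; rewrite -dist => h.
  by rewrite (@rnormE R k K^o (`|T| - `|T (x n)|)) -e_re ltr_scalar_of.
split=> -[x1 Tx]; split.
- by move=> n; rewrite -unit_ballE.
- exact/cvE.
- by move=> n; rewrite unit_ballE.
- exact/cvE.
Qed.

Lemma attains_normP (T : 'L(X, Y)) :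
  attains_norm T <-> exists2 x : X, rnorm x = 1 & rnorm (T x) = rnorm T.
Proof.
split=> -[x x1 Tx]; exists x.
- by rewrite /rnorm x1 -(scalar_of1 R k) scalar_ofK.
- by rewrite /rnorm Tx.
- by rewrite rnormE x1 scalar_of1.
- by rewrite !rnormE Tx.
Qed.

End maximizing.

Section WMP_strictM.
Variables (R : realType) (k : scalar_kind) (X : normedModType (scalars R k)).
Local Notation K := (scalars R k).
Local Notation c0 := (c0 R k).

(** Coordinates with a bounded index see neither the weakly null sequence nor
    more of [y] than its norm, which is smaller than [L]; far coordinates see
    neither [y] nor [T x], so that there [x] may replace [y]. *)
Lemma escaping_coordinates (T : 'L(X, c0)) (x : X) (y : c0) (x_ : nat -> X) (L : R) :
  rnorm y < rnorm x -> rnorm x <= L -> weakly_null x_ ->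
  (forall e, 0 < e -> \forall n \near \oo, rnorm (x + x_ n) < L + e) ->
  (forall e N, 0 < e -> exists n, (N <= n)%N /\ L - e < rnorm (y + T (x_ n))) ->
  forall e M, 0 < e -> exists m n, [/\ (M <= m)%N, (M <= n)%N,
    rnorm (x + x_ n) < L + e & L - e < rnorm (T (x + x_ n) m)].
Proof.
move=> yx xL wx Lsup Linf e M e0.
(* a third of [e] for each of [y m], [T x m] and the upper limit; the other
   bound rules out the coordinates below [M'] *)
pose d := Num.min (e / 3) ((rnorm x - rnorm y) / 2).
have d0 : 0 < d by rewrite lt_min; apply/andP; split; lra.
have de : d <= e / 3 by rewrite /d ge_min lexx.
have dxy : d <= (rnorm x - rnorm y) / 2 by rewrite /d ge_min lexx orbT.
have [My yM] := c0_near y d0; have [Mx xM] := c0_near (T x) d0.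
pose M' := (M + (My + Mx))%N.
have [N1 _ N1P] : \forall n \near \oo, forall m, (m < M')%N -> rnorm (T (x_ n) m) < d.
  elim: M' => [|m IH]; first by apply: filterE => n m; rewrite ltn0.
  have [f fT] := c0_coord_functional T m.
  have fd : \forall n \near \oo, rnorm (f (x_ n)) < d.
    exact: (scalar_cvg0P _ _).1 (wx f) _ d0.
  apply: filterS2 IH fd => n h1 h2 i.
  by rewrite ltnS leq_eqVlt => /predU1P[->|/h1//]; rewrite -fT.
have [N2 _ N2P] := Lsup _ e0.
have [n [le_n Ln]] := Linf d (M + (N1 + N2))%N d0.
have [m mE] := c0_norm_attained (y + T (x_ n)).
have Mm : (M' <= m)%N.
  rewrite leqNgt; apply/negP => /N1P; move=> /(_ n) h.
  have {h} : rnorm (T (x_ n) m) < d.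
    by apply: h => /=; rewrite (leq_trans _ le_n)// addnCA leq_addr.
  have := c0_coord_le y m; have := ler_rnormD (y m) (T (x_ n) m).
  by rewrite -c0_coordD mE; lra.
exists m, n; split.
- by rewrite (leq_trans _ Mm)// leq_addr.
- by rewrite (leq_trans _ le_n)// leq_addr.
- by apply: N2P => /=; rewrite (leq_trans _ le_n)// addnA leq_addl.
have ym : rnorm (y m) < d by apply: yM; rewrite (leq_trans _ Mm)// /M' addnCA leq_addr.
have xm : rnorm (T x m) < d by apply: xM; rewrite (leq_trans _ Mm)// /M' addnA leq_addl.
have := ler_rnormD (y m) (T (x_ n) m); rewrite -c0_coordD mE.
have := ler_rnormB (T (x_ n) m) (- T x m); rewrite rnormN opprK.
by rewrite linearD c0_coordD [T x m + _]addrC; lra.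
Qed.

(** The vectors [x + x_n] at which the escaping coordinates are almost [L] are
    maximizing for the shrunk operator, which does not attain its norm. *)
Lemma WMP_strictM : WMP X c0 -> strictM X c0.
Proof.
move=> wmp T T1 x y; rewrite !rnormE ltr_scalar_of => yx x_ wx.
have {}T1 : rnorm T <= 1 by rewrite -(ler_scalar_of k) -rnormE scalar_of1.
rewrite ltNge; apply/negP => le_sup.
have [C xC] := weakly_null_bounded wx.
have [f [f1 fx]] := norming_functional x.
have /weakly_nullP/(_ f) fx_ := wx.
have Lfin : limn_esup (fun n => (rnorm (x + x_ n))%:E) \is a fin_num.
  apply: (@limn_esup_fin_num _ _ (rnorm x + C)) => n.
  by rewrite rnorm_ge0 (le_trans (ler_rnormD _ _))// lerD2l.
pose L := fine (limn_esup (fun n => (rnorm (x + x_ n))%:E)).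
have LE : limn_esup (fun n => (rnorm (x + x_ n))%:E) = L%:E by rewrite fineK.
have Lsup e : 0 < e -> \forall n \near \oo, rnorm (x + x_ n) < L + e.
  by move=> e0; apply: limn_esup_lt; rewrite LE lte_fin ltrDl.
have Linf e N : 0 < e -> exists n, (N <= n)%N /\ L - e < rnorm (y + T (x_ n)).
  move=> e0; apply: limn_esup_gt; apply: lt_le_trans le_sup.
  by rewrite LE lte_fin ltrBlDr ltrDl.
have xL : rnorm x <= L.
  apply/ler_addgt0Pr => e e0.
  have cv : scalar_re (f (x + x_ n)) @[n --> \oo] --> rnorm x + 0.
    under eq_fun do rewrite dual_reD fx.
    by apply: cvgD; [exact: cvg_cst|exact: fx_].
  rewrite addr0 in cv.
  rewrite -(cvg_lim (@Rhausdorff R) cv); apply: limr_le.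
    by apply/cvg_ex; eexists; exact: cv.
  apply: filterS (Lsup _ e0) => n /ltW; apply: le_trans.
  by rewrite (le_trans (ler_norm _))// (le_trans (ler_scalar_re _)).
have x0 : 0 < rnorm x by rewrite (le_lt_trans _ yx)// rnorm_ge0.
pose t j : R := j.+1%:R^-1.
have t0 j : 0 < t j by rewrite invr_gt0.
have t1 j : t j <= 1 by rewrite invf_le1 ?ltr0n// ler1n.
have t_cvg : t @ \oo --> (0 : R) by exact: cvg_harmonic.
have /choice[mn mnP] j : exists mn : nat * nat, [/\ (j <= mn.1)%N, (j <= mn.2)%N,
    rnorm (x + x_ mn.2) < L + t j & L - t j < rnorm (T (x + x_ mn.2) mn.1)].
  have [m [n h]] := escaping_coordinates yx xL wx Lsup Linf j (t0 j).
  by exists (m, n).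
(* at [j = 0] the factor is [0], which is harmless *)
have [S SE] : exists S : 'L(X, c0), forall z j,
    S z j = scalar_of k (1 - t j) * T z (mn j).1 :> K.
  by apply: shrunk_coordinates => j; have [] := mnP j.
have Slt z : rnorm z = 1 -> rnorm (S z) < 1.
  move=> z1; have [j <-] := c0_norm_attained (S z).
  rewrite SE rnormM rnorm_scalar_of ger0_norm ?subr_ge0//.
  have Tz : rnorm (T z (mn j).1) <= 1.
    rewrite (le_trans (c0_coord_le _ _))// (le_trans (ler_rnorm_operator _ _))//.
    by rewrite z1 mulr1.
  rewrite (@le_lt_trans _ _ (1 - t j))// ?ler_piMr ?subr_ge0//.
  by rewrite ltrBlDr ltrDl.
pose w j : X := scalar_of k (L + t j)^-1 *: (x + x_ (mn j).2).
have Lt j : 0 < L + t j by have := t0 j; lra.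
have w1 j : rnorm (w j) <= 1.
  rewrite rnormZ_of ger0_norm ?invr_ge0 ?(ltW (Lt j))// ler_pdivrMl// mulr1.
  by have [_ _ /ltW] := mnP j.
have S1 : rnorm S <= 1.
  rewrite rnorm_operator; apply: ge_sup; first exact: (operator_has_sup S).1.
  move=> _ [z /= + <-]; rewrite unit_ballE => z1.
  have [j <-] := c0_norm_attained (S z).
  rewrite SE rnormM rnorm_scalar_of mulr_ile1 ?normr_ge0 ?rnorm_ge0//.
    by rewrite ger0_norm ?subr_ge0// gerBl ltW.
  rewrite (le_trans (c0_coord_le _ _))// (le_trans (ler_rnorm_operator _ _))//.
  by rewrite mulr_ile1 ?rnorm_ge0.
have Sw j : rnorm (S (w j)) <= rnorm S.
  by rewrite (le_trans (ler_rnorm_operator _ _))// ler_piMr// rnorm_ge0.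
have Sw_lb j : (1 - t j) * ((L - t j) / (L + t j)) <= rnorm (S (w j)).
  rewrite (le_trans _ (c0_coord_le _ j))// SE rnormM rnorm_scalar_of.
  rewrite ger0_norm ?subr_ge0// ler_wpM2l ?subr_ge0//.
  rewrite /w linearZ c0_coordZ rnormM rnorm_scalar_of ger0_norm ?invr_ge0 ?(ltW (Lt j))//.
  by rewrite mulrC ler_wpM2l ?invr_ge0 ?(ltW (Lt j))//; have [_ _ _ /ltW] := mnP j.
have lb_cvg : (1 - t j) * ((L - t j) / (L + t j)) @[j --> \oo] -->
    (1 - 0) * ((L - 0) / (L + 0)).
  apply: cvgM; first by apply: cvgB; [exact: cvg_cst|exact: t_cvg].
  apply: cvgM; first by apply: cvgB; [exact: cvg_cst|exact: t_cvg].
  apply: cvgV; first by rewrite addr0 gt_eqF//; lra.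
  by apply: cvgD; [exact: cvg_cst|exact: t_cvg].
rewrite !subr0 addr0 divff ?mulr1 in lb_cvg; last by rewrite gt_eqF//; lra.
have SwS : rnorm (S (w j)) @[j --> \oo] --> (1 : R).
  apply: squeeze_cvgr lb_cvg (cvg_cst _).
  by apply: filterE => j; rewrite Sw_lb (le_trans (Sw j)).
have S_eq1 : rnorm S = 1.
  apply/eqP; rewrite eq_le S1/= -(cvg_lim (@Rhausdorff R) SwS).
  by apply: limr_le; [apply/cvg_ex; exists 1|exact: filterE].
suff /attains_normP[z z1] : attains_norm S.
  by rewrite S_eq1 => Sz; have := Slt _ z1; rewrite Sz ltxx.
apply: wmp; exists w.
  by apply/maximizing_sequenceP; rewrite S_eq1; split.
move=> /weakly_nullP/(_ f) fw.
have fw' : scalar_re (f (w j)) @[j --> \oo] --> (L + 0)^-1 * (rnorm x + 0).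
  under eq_fun do rewrite dual_reZ dual_reD fx.
  apply: cvgM.
    apply: cvgV; first by rewrite addr0 gt_eqF//; lra.
    by apply: cvgD; [exact: cvg_cst|exact: t_cvg].
  apply: cvgD; first exact: cvg_cst.
  have /weakly_null_sub/(_ wx)/weakly_nullP/(_ f)// : forall j, (j <= (mn j).2)%N.
  by move=> j; have [] := mnP j.
have := cvg_lim (@Rhausdorff R) fw'; rewrite (cvg_lim (@Rhausdorff R) fw) !addr0.
by move=> /(_ _)/esym/eqP; rewrite mulf_eq0 invr_eq0 !gt_eqF//; lra.
Qed.

End WMP_strictM.

Section strictM_WMP.
Variables (R : realType) (k : scalar_kind) (X Y : normedModType (scalars R k)).
Local Notation K := (scalars R k).
Hypothesis reflX : reflexive_space X.

(** If [T], scaled to norm [1], does not attain its norm, then [|T z| < |z|] at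
    the nonzero weak limit [z] of a maximizing sequence, and strict (M) keeps
    the upper limit of the norms of the images below [1]. *)
Lemma strictM_WMP : strictM X Y -> WMP X Y.
Proof.
move=> sM T [x /maximizing_sequenceP[x1 Tx] nwx].
have [f [e e0 /choice[psi psiP]]] : exists f : dual X, exists2 e : R, 0 < e &
    forall n, exists m, (n <= m)%N /\ e <= rnorm (f (x m)).
  apply: contrapT => h; apply: nwx => f; apply/scalar_cvg0P => e e0.
  apply: contrapT => he; apply: h; exists f, e => // n.
  apply: contrapT => hn; apply: he; exists n => // m /= nm.
  by rewrite ltNge; apply/negP => hm; apply: hn; exists m.
(* along [psi] the functional [f] stays away from [0], so that the weak limit
   [z] of a further subsequence cannot be [0] *)
have [phi [z [le_phi wz]]] :=
  weakly_convergent_subsequence reflX (fun n => x1 (psi n)).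
have z0 : z != 0.
  apply/eqP => z0; have [N _ /(_ N (leqnn N))/=] := (scalar_cvg0P _ _).1 (wz f) _ e0.
  rewrite z0 subr0 ltNge.
  by rewrite (psiP _).2.
apply: contrapT => nattained.
have T_gt0 : 0 < rnorm T.
  rewrite lt_neqAle rnorm_ge0 andbT eq_sym; apply/eqP => T0.
  apply: nattained; apply/attains_normP.
  exists (scalar_of k (rnorm z)^-1 *: z).
    by rewrite rnormZ_of ger0_norm ?invr_ge0 ?rnorm_ge0// mulVf// gt_eqF// rnorm_gt0.
  by rewrite T0 (rnorm_eq0 T0) rnorm0.
pose U : 'L(X, Y) := scalar_of k (rnorm T)^-1 *: T.
have UE v : U v = scalar_of k (rnorm T)^-1 *: T v by [].
have U1 : `|U| <= 1.
  rewrite rnormE -(scalar_of1 R k) ler_scalar_of rnormZ_of.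
  by rewrite ger0_norm ?invr_ge0 ?rnorm_ge0// mulVf// gt_eqF.
have Uz : `|U z| < `|z|.
  rewrite !rnormE ltr_scalar_of UE rnormZ_of ger0_norm ?invr_ge0 ?rnorm_ge0//.
  rewrite ltr_pdivrMl// lt_neqAle ler_rnorm_operator andbT.
  apply/eqP => Tz; apply: nattained; apply/attains_normP.
  have nz := rnorm_gt0 z0.
  exists (scalar_of k (rnorm z)^-1 *: z).
    by rewrite rnormZ_of ger0_norm ?invr_ge0 ?rnorm_ge0// mulVf// gt_eqF.
  rewrite linearZ rnormZ_of Tz ger0_norm ?invr_ge0 ?rnorm_ge0//.
  by rewrite mulrCA mulVf ?mulr1// gt_eqF.
have := sM U U1 z (U z) Uz _ wz; rewrite ltNge => /negP; apply.
have UxE n : U z + U (x (psi (phi n)) - z) = U (x (psi (phi n))).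
  by rewrite -linearD addrCA subrr addr0.
under [X in (_ <= limn_esup X)%E]eq_fun do rewrite UxE.
have Ux : rnorm (U (x (psi (phi n)))) @[n --> \oo] --> (1 : R).
  under eq_fun do rewrite UE rnormZ_of ger0_norm ?invr_ge0 ?rnorm_ge0//.
  rewrite -(mulVf (x := rnorm T)) ?gt_eqF//; apply: cvgMr.
  apply: cvg_comp Tx => A [N _ NA]; exists N => // n /= Nn; apply: NA => /=.
  by rewrite (leq_trans Nn)// (leq_trans (le_phi n))// (psiP _).1.
have -> : limn_esup (fun n => (rnorm (U (x (psi (phi n)))))%:E) = 1%:E.
  have cvE : (rnorm (U (x (psi (phi n)))))%:E @[n --> \oo] --> 1%:E.
    by apply: cvg_EFin => //; exact: filterE.
  rewrite is_cvg_limn_esupE; first exact: cvg_lim.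
  by apply/cvg_ex; exists 1%:E.
by apply: limn_esup_le => n; rewrite addrCA subrr addr0 x1.
Qed.

End strictM_WMP.

Theorem theorem3p2 (R : realType) (k : scalar_kind)
    (X : completeNormedModType (scalars R k)) :
  reflexive_space X -> (WMP X (c0 R k) <-> strictM X (c0 R k)).
Proof.
by move=> reflX; split; [exact: WMP_strictM|exact: strictM_WMP].
Qed.
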